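(* Let $n\geqslant1$, let $p_1,\dots,p_n$ be distinct primes and $G=C_{p_1\cdots p_n}$. Then \[ \mathfrak{c}(G)\geqslant\begin{cases}\sum_{i=0}^{\lfloor\frac{n-1}{2}\rfloor}\binom{n}{n-i}\binom{n-i}{i+1} & n=2,4,6,\\[4pt] \sum_{i=0}^{\lfloor\frac{n-1}{2}\rfloor}\binom{n}{n-i}\binom{n-i}{i} & n\neq2,4,6.\end{cases} \] Moreover, this value is the maximal size of a rainbow on $\{0,\dots,n\}$, and it is attained by the complete rainbow when $n$ is odd, uniquely among rainbows by $R[n/2]$ when $n\geqslant8$ is even, and by both $R[0]$ and $R[n]$ when $n=2,4,6$.
   Context: For a finite group $G$, an arrow is a pair $(H,K)$ of subgroups with $H\leqslant K$; identity arrows are those with $H=K$. A $G$-transfer system is a set of arrows containing all identities and closed under composition ($(H,K),(K,L)\Rightarrow(H,L)$), conjugation ($(H,K)\Rightarrow(gHg^{-1},gKg^{-1})$) and restriction ($(H,K)$ and $L\leqslant K\Rightarrow(H\cap L,L)$). For a set $S$ of non-identity arrows, $\langle S\rangle$ is the smallest transfer system containing $S$. A minimal generating set of a transfer system $\mathsf{T}$ is a set $S\subseteq\mathsf{T}$ of non-identity arrows with $\langle S\rangle=\mathsf{T}$ and $\langle S\setminus\{s\}\rangle\neq\mathsf{T}$ for all $s\in S$; all such have the same cardinality $\mathfrak{m}(\mathsf{T})$. The complexity $\mathfrak{c}(G)$ is the maximum of $\mathfrak{m}(\mathsf{T})$ over all $G$-transfer systems $\mathsf{T}$. For $G=C_{p_1\cdots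 p_n}$ and $0\leqslant x<y\leqslant n$, the arc $\underline{x}\to\underline{y}$ stands for the set of all arrows $(H,K)$ where $|H|$ is a product of $x$ of the primes and $|K|$ a product of $y$ of the primes; it contains $\binom{n}{x,\,y-x,\,n-y}=\frac{n!}{x!(y-x)!(n-y)!}$ arrows. A rainbow on $\{0,\dots,n\}$ is a set of arcs $\{\underline{x_i}\to\underline{y_i}\}_{0\leqslant i\leqslant m}$ with $x_0<x_1<\dots<x_m<y_m<\dots<y_0$; its size is $\sum_i\binom{n}{x_i,\,y_i-x_i,\,n-y_i}$ (the number of arrows in the union of its arcs). For $n$ odd, the complete rainbow is the rainbow with arcs $\underline{i}\to\underline{n-i}$ for $0\leqslant i\leqslant\frac{n-1}{2}$ (every element of $\{0,\dots,n\}$ is an endpoint). For $n$ even and $0\leqslant x\leqslant n$, $R[x]$ is the rainbow with $\frac n2$ arcs whose endpoints are all elements of $\{0,\dots,n\}$ except $x$. Attaining the value means that the union of the arcs' arrows is a minimal generating set of the transfer system it generates, whose cardinality is the rainbow's size. *)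

(* Defs.v *)
From mathcomp Require Import all_boot all_fingroup all_solvable.
Set Implicit Arguments. Unset Strict Implicit. Unset Printing Implicit Defensive.

Local Open Scope nat_scope.

Section TransferSystems.
Variable gT : finGroupType.
Variable G : {group gT}.

Definition arrow_type := ({group gT} * {group gT})%type.

Definition is_arrow (a : arrow_type) : bool := (a.1 \subset a.2) && (a.2 \subset G).

Definition transferb (T : {set arrow_type}) : bool :=
  [&& [forall a in T, is_arrow a],
      [forall H : {group gT}, (H \subset G) ==> ((H, H) \in T)],
      [forall H : {group gT}, forall K : {group gT}, forall L : {group gT},
          ((H, K) \in T) && ((K, L) \in T) ==> ((H, L) \in T)],
      [forall H : {group gT}, forall K : {group gT}, forall g in G,
          ((H, K) \in T) ==> (((H :^ g)%G, (K :^ g)%G) \in T)] &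
      [forall H : {group gT}, forall K : {group gT}, forall L : {group gT},
          ((H, K) \in T) && (L \subset K) ==> (((H :&: L)%G, L) \in T)]].

Definition gen (S : {set arrow_type}) : {set arrow_type} :=
  \bigcap_(T | transferb T && (S \subset T)) T.

Definition minimal_genb (S T : {set arrow_type}) : bool :=
  [&& [forall a in S, a.1 != a.2], S \subset T, gen S == T &
      [forall s in S, gen (S :\ s) != T]].

(* m(T): the (common) cardinality of minimal generating sets of T *)
Definition mfrak (T : {set arrow_type}) : nat :=
  \max_(S | minimal_genb S T) #|S|.

Definition cfrak : nat := \max_(T | transferb T) mfrak T.

Definition arc_arrows (n : nat) (p : 'I_n -> nat) (x y : nat) : {set arrow_type} :=
  [set a : arrow_type | [&& is_arrow a,
     [exists I : {set 'I_n}, (#|I| == x) && (#|a.1| == \prod_(i in I) p i)] &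
     [exists I : {set 'I_n}, (#|I| == y) && (#|a.2| == \prod_(i in I) p i)]]].

Definition rainbow_arrows (n : nat) (p : 'I_n -> nat) (r : seq (nat * nat))
  : {set arrow_type} :=
  \bigcup_(a <- r) arc_arrows p a.1 a.2.

End TransferSystems.

(* Rainbows on {0,...,n}: the arcs (x_0,y_0),...,(x_m,y_m) listed in order,
   with x_0 < ... < x_m < y_m < ... < y_0 <= n, m >= 0. *)
Definition rainbow (n : nat) (r : seq (nat * nat)) : bool :=
  [&& r != [::], sorted ltn (map fst r), sorted gtn (map snd r),
      (last (0, 0) r).1 < (last (0, 0) r).2 & all (fun a => a.2 <= n) r].

Definition multinom (n x y : nat) : nat := n`! %/ (x`! * (y - x)`! * (n - y)`!).

Definition rsize (n : nat) (r : seq (nat * nat)) : nat :=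
  \sum_(a <- r) multinom n a.1 a.2.

Definition complete_rainbow (n : nat) : seq (nat * nat) :=
  [seq (i, n - i) | i <- iota 0 ((n - 1)./2).+1].

(* R[x] (n even): n/2 nested arcs on all points of {0..n} except x *)
Definition Rx (n x : nat) : seq (nat * nat) :=
  let s := [seq k <- iota 0 n.+1 | k != x] in
  [seq (nth 0 s i, nth 0 s (n - 1 - i)) | i <- iota 0 n./2].

Definition bound (n : nat) : nat :=
  if n \in [:: 2; 4; 6] then
    \sum_(0 <= i < ((n - 1)./2).+1) 'C(n, n - i) * 'C(n - i, i.+1)
  else
    \sum_(0 <= i < ((n - 1)./2).+1) 'C(n, n - i) * 'C(n - i, i).

Definition attains (gT : finGroupType) (G : {group gT}) (n : nat) (p : 'I_n -> nat)
  (r : seq (nat * nat)) : Prop :=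
  [/\ rainbow n r, rsize n r = bound n,
      #|rainbow_arrows G p r| = rsize n r &
      minimal_genb G (rainbow_arrows G p r) (gen G (rainbow_arrows G p r))].

(* Main.v *)
Require Import Defs.
From mathcomp Require Import all_boot all_fingroup all_solvable.
From mathcomp Require Import all_order all_algebra zify ring lra.

(* Minimality.  In a cyclic group of squarefree order, two distinct arrows of a
   rainbow are never comparable componentwise: the levels force them into the
   same arc, and then to be equal.  For an arrow [(A, B)] the arrows [(H, K)]
   such that [A <= H] and [B <= K] imply [B <= H] form a transfer system, which
   therefore contains all arrows of the rainbow but [(A, B)].

   Maximality.  An arc of length [b] has at most
   [f b = 'C(n, b) * 'C(n - b, (n - b)./2)] arrows, with equality for [b] of the
   parity of [n] only if it is concentric with [0 -> n].  The lengths in a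
   rainbow pairwise differ by at least 2, so the size of a rainbow is at most
   the maximal weight of an independent set in the path [1 - ... - n] weighted
   by [f].  For [n] odd or [n >= 8] an explicit LP-dual solution shows that the
   lengths of the parity of [n] are optimal; complementary slackness gives
   uniqueness. *)

Set Implicit Arguments. Unset Strict Implicit. Unset Printing Implicit Defensive.
Import Order.TTheory GRing.Theory Num.Theory.

(** * Sizes of arcs *)

Lemma multinomE n x y : x <= y -> y <= n ->
  multinom n x y = 'C(n, y) * 'C(y, x).
Proof.
move=> xy yn; rewrite /multinom -(bin_fact yn) -(bin_fact xy).
set a := 'C(n, y); set b := 'C(y, x).
have -> : a * (b * (x`! * (y - x)`!) * (n - y)`!)
   = a * b * (x`! * (y - x)`! * (n - y)`!) by ring.
by rewrite mulnK // !muln_gt0 !fact_gt0.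
Qed.

Lemma multinomE_len n x y : x <= y -> y <= n ->
  multinom n x y = 'C(n, y - x) * 'C(n - (y - x), x).
Proof.
move=> xy yn; have bn : y - x <= n by lia.
have xn : x <= n - (y - x) by lia.
rewrite /multinom -(bin_fact bn) -(bin_fact xn).
have -> : n - (y - x) - x = n - y by lia.
set a := 'C(n, _); set b := 'C(_, x).
have -> : a * ((y - x)`! * (b * (x`! * (n - y)`!)))
   = a * b * (x`! * (y - x)`! * (n - y)`!) by ring.
by rewrite mulnK // !muln_gt0 !fact_gt0.
Qed.

Lemma bin_ltn_succ N k : k.*2.+1 < N -> 'C(N, k) < 'C(N, k.+1).
Proof.
move=> kN; have := mul_bin_left N k.
have : 0 < 'C(N, k) by rewrite bin_gt0; lia.
by move: 'C(N, k) 'C(N, k.+1) => a b; nia.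
Qed.

Lemma bin_lt_below N k l : k < l -> l <= N./2 -> 'C(N, k) < 'C(N, l).
Proof.
elim: l => // l IH; rewrite ltnS leq_eqVlt => /orP[/eqP-> | kl] lN.
  by apply: bin_ltn_succ; lia.
apply: ltn_trans (IH kl _) _; first lia.
by apply: bin_ltn_succ; lia.
Qed.

Lemma bin_le_half N k : 'C(N, k) <= 'C(N, N./2).
Proof.
have [kN|Nk] := ltnP N k; first by rewrite bin_small.
have [kh|] := ltnP k N./2; first by rewrite ltnW ?bin_lt_below.
rewrite leq_eqVlt => /orP[/eqP<- // | kh].
rewrite -bin_sub //.
have : N - k <= N./2 by lia.
by rewrite leq_eqVlt => /orP[/eqP-> // | lt]; rewrite ltnW ?bin_lt_below.
Qed.

Lemma bin_eq_half N k : ~~ odd N -> 'C(N, k) = 'C(N, N./2) -> k = N./2.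
Proof.
move=> evN E.
have [kh|kh|//] := ltngtP k N./2.
  by have := bin_lt_below kh (leqnn _); rewrite E ltnn.
have kN : k <= N.
  rewrite leqNgt; apply/negP => Nk; move: E; rewrite bin_small // => E.
  by have := bin_gt0 N N./2; rewrite -E; lia.
have /bin_lt_below/(_ (leqnn _)) : N - k < N./2 by lia.
by rewrite bin_sub // E ltnn.
Qed.

(** The weight [f] above: the multinomial coefficient of [n] with one part [b] and two parts as
    equal as possible. *)
Definition max_arc n b := 'C(n, b) * 'C(n - b, (n - b)./2).

Lemma multinom_le_max_arc n x y : x <= y -> y <= n ->
  multinom n x y <= max_arc n (y - x).
Proof. by move=> xy yn; rewrite multinomE_len // leq_mul ?bin_le_half. Qed.

(** When [n - (y - x)] is even, its central binomial coefficient is a strict maximum, reached only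
    at [x = n - y]. *)
Lemma multinom_eq_max_arc n x y : x <= y -> y <= n -> ~~ odd (n - (y - x)) ->
  multinom n x y = max_arc n (y - x) -> x + y = n.
Proof.
move=> xy yn ev; rewrite multinomE_len // /max_arc => /eqP.
rewrite eqn_pmul2l ?bin_gt0; last lia.
by move=> /eqP /(bin_eq_half ev); lia.
Qed.

Lemma max_arc_gt0 n b : b <= n -> 0 < max_arc n b.
Proof. by move=> bn; rewrite muln_gt0 !bin_gt0 bn /=; lia. Qed.

Lemma max_arcE n b a c : n = a + b + c -> (c == a) || (c == a.+1) ->
  max_arc n b * (a`! * b`! * c`!) = n`!.
Proof.
move=> En ac; have bn : b <= n by lia.
have Ea : (n - b)./2 = a by lia.
have an : a <= n - b by lia.
rewrite /max_arc Ea -(bin_fact bn) -(bin_fact an).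
have -> : n - b - a = c by lia.
by ring.
Qed.

(** The outer parts [m] and [m.+1] become equal: a factor [m.+1] of the denominator is traded for
    [k.+1]. *)
Lemma max_arc_up n k m : n = m.*2 + k + 1 ->
  max_arc n k.+1 * k.+1 = max_arc n k * m.+1.
Proof.
move=> En.
have E1 : n = m + k + m.+1 by lia.
have E2 : n = m + k.+1 + m by lia.
have := max_arcE E1; rewrite eqxx orbT => /(_ isT).
have := max_arcE E2; rewrite eqxx => /(_ isT) <-.
rewrite !factS => E; apply/eqP.
have/eqn_pmul2r <- : 0 < m`! * k`! * m`! by rewrite !muln_gt0 !fact_gt0.
by apply/eqP; move: E; set A := max_arc n k; set B := max_arc n k.+1; lia.
Qed.

Lemma max_arc_down n k m : n = m.*2 + k ->
  max_arc n k * m = max_arc n k.+1 * k.+1.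
Proof.
case: m => [|m] En.
  have -> : n = k by lia.
  by rewrite /max_arc (bin_small (ltnSn k)) muln0.
have E1 : n = m.+1 + k + m.+1 by lia.
have E2 : n = m + k.+1 + m.+1 by lia.
have := max_arcE E1; rewrite eqxx => /(_ isT).
have := max_arcE E2; rewrite eqxx orbT => /(_ isT) <-.
rewrite !factS => E; apply/eqP.
have/eqn_pmul2r <- : 0 < m`! * k`! * (m.+1 * m`!).
  by rewrite !muln_gt0 !fact_gt0.
by apply/eqP; move: E; set A := max_arc n k; set B := max_arc n k.+1; lia.
Qed.

(** * Rainbows *)

Lemma rainbow_cons n a b r : rainbow n (a :: b :: r) ->
  [/\ rainbow n (b :: r), a.1 < b.1, b.2 < a.2 & a.2 <= n].
Proof.
case/and5P => _ /= /andP[s1 s1'] /andP[s2 s2'] l /and3P[an bn rn].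
by split=> //; apply/and5P; split=> //=; rewrite bn.
Qed.

Lemma rainbow_head n a r : rainbow n (a :: r) -> a.1 < a.2 <= n.
Proof.
elim: r a => [|b r IH] a; first by case/and5P=> _ _ _ /= -> /andP[->].
by case/rainbow_cons => /IH; lia.
Qed.

Lemma rainbow_inside n a r b : rainbow n (a :: r) -> b \in r ->
  a.1 < b.1 /\ b.2 < a.2.
Proof.
elim: r a => [|c r IH] a // /rainbow_cons[rb ac ca _].
by rewrite inE => /predU1P[-> // | /(IH _ rb)[]]; lia.
Qed.

Lemma rainbow_behead n a r : rainbow n (a :: r) -> r != [::] -> rainbow n r.
Proof. by case: r => // b r /rainbow_cons[]. Qed.

Lemma rainbow_mem n r a : rainbow n r -> a \in r -> a.1 < a.2 <= n.
Proof.
elim: r => // b r IH rb; rewrite inE => /predU1P[-> | ar].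
  exact: rainbow_head rb.
by apply: IH (ar); apply: rainbow_behead rb _; case: (r) ar.
Qed.

(** Of two distinct arcs one lies strictly inside the other at both ends; this is the source of the
    incomparability of arrows. *)
Lemma rainbow_nested n r : rainbow n r ->
  {in r &, forall a b, a.1 <= b.1 -> a.2 <= b.2 -> a = b}.
Proof.
elim: r => // c r IH rb a b; rewrite !inE.
move=> /predU1P[-> | ar] /predU1P[-> | br] //.
- by have [_ lt] := rainbow_inside rb br; move=> _ /(leq_trans lt); rewrite ltnn.
- by have [lt _] := rainbow_inside rb ar; move=> /(leq_trans lt); rewrite ltnn.
by apply: IH => //; apply: rainbow_behead rb _; case: (r) ar.
Qed.

Lemma rainbow_uniq n r : rainbow n r -> uniq r.
Proof.
case/and5P=> _ srt _ _ _; apply: (@map_uniq _ _ fst).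
exact: sorted_uniq ltn_trans ltnn _ srt.
Qed.

Definition outer_len (r : seq (nat * nat)) :=
  if r is a :: _ then a.2 - a.1 else 0.

Lemma rainbow_outer_len n a r : rainbow n (a :: r) -> r != [::] ->
  rainbow n r /\ outer_len r + 2 <= outer_len (a :: r).
Proof.
case: r => // b r /rainbow_cons[br ab ba an] _; split=> //=.
by have := rainbow_head br; lia.
Qed.

Lemma rainbow_outer_len_le n r : rainbow n r -> outer_len r <= n.
Proof. by case: r => // a r /rainbow_head /=; lia. Qed.

(** * Upper bounds by recursion on the outer length *)

Section Majorant.
Variables (n : nat) (P : nat -> rat).
Hypothesis P0 : (0 <= P 0)%R.
Hypothesis P_mono : forall b, b < n -> (P b <= P b.+1)%R.
Hypothesis P1 : 0 < n -> ((max_arc n 1)%:R <= P 1)%R.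
Hypothesis P_step : forall b, b.+2 <= n ->
  ((max_arc n b.+2)%:R + P b <= P b.+2)%R.

Lemma majorant_mono b c : b <= c -> c <= n -> (P b <= P c)%R.
Proof.
elim: c => [|c IH]; first by rewrite leqn0 => /eqP->.
rewrite leq_eqVlt => /orP[/eqP-> //|bc] cn.
by apply: le_trans (IH _ (ltnW cn)) (P_mono cn).
Qed.

Lemma majorant_ge0 b : b <= n -> (0 <= P b)%R.
Proof. by move=> bn; apply: le_trans P0 (majorant_mono _ _). Qed.

(** Peeling off an outermost arc of length [b.+2] leaves arcs of length at most [b], so [P_step]
    pays for it; an arc of length 1 contains no other and is paid for by [P1]. The values are
    rational because the dual weights are. *)
Lemma rsize_le_majorant r : rainbow n r -> ((rsize n r)%:R <= P (outer_len r))%R.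
Proof.
elim: r => [|a r IH] rb; first by case/andP: rb.
have /andP[lt_a an] := rainbow_head rb.
rewrite /rsize big_cons natrD.
have le_a : ((multinom n a.1 a.2)%:R <= (max_arc n (a.2 - a.1))%:R :> rat)%R.
  by rewrite ler_nat multinom_le_max_arc // ltnW.
case: r => [|b r] in IH rb *.
  rewrite big_nil addr0; apply: le_trans le_a _ => /=.
  move: (a.2 - a.1) (leq_trans (leq_subr a.1 a.2) an) (subn_gt0 a.1 a.2).
  rewrite lt_a => -[|[|l]] // ln _; first exact: P1.
  by have := P_step ln; have /majorant_ge0 : l <= n by [lia]; lra.
have [rb' len] := rainbow_outer_len rb isT.
have := IH rb'; rewrite /rsize; move: len le_a => /=.
case: (a.2 - a.1) (leq_trans (leq_subr a.1 a.2) an) => [|[|l]] ln; try lia.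
move=> len le_a; have := P_step ln.
by have /majorant_mono : b.2 - b.1 <= l by [lia]; move/(_ (ltnW (ltnW ln))); lra.
Qed.

Lemma rsize_le_majorant_n r : rainbow n r -> ((rsize n r)%:R <= P n)%R.
Proof.
move=> rb; apply: le_trans (rsize_le_majorant rb) (majorant_mono _ _) => //.
case: r rb => [|a r] // /rainbow_head /andP[_ an] /=.
by apply: leq_trans an; apply: leq_subr.
Qed.

End Majorant.

(* Dual certificate.  The lengths [j] with the parity of [n] are a maximum weight
   independent set of the path [1 - 2 - ... - n] with vertex weights
   [max_arc n j]: each such weight is split between the two incident edges, the
   fraction [2 (j + 1) / (n + j + 2)] going to the edge [(j - 1, j)], so that
   every other vertex is dominated by its incident edges. *)
Definition arc_weight n b : rat :=
  ((max_arc n b)%:R * (b.+1.*2)%:R / (n + b + 2)%:R)%R.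

Definition same_parity_sum n b := \sum_(1 <= j < b.+1 | odd j == odd n) max_arc n j.

(* The total weight of the edges [(j - 1, j)] with [j <= b + 1]. *)
Definition potential n b : rat :=
  ((same_parity_sum n b)%:R + (if odd b == odd n then 0 else arc_weight n b.+1))%R.

Lemma same_parity_sumS n b : same_parity_sum n b.+1 =
  same_parity_sum n b + (if odd b.+1 == odd n then max_arc n b.+1 else 0).
Proof.
by rewrite /same_parity_sum [LHS]big_mkcond big_nat_recr //= -big_mkcond.
Qed.

Lemma arc_weight_ge0 n b : (0 <= arc_weight n b)%R.
Proof. by rewrite /arc_weight divr_ge0 ?mulr_ge0 ?ler0n. Qed.

Lemma arc_weight_gt0 n b : b <= n -> (0 < arc_weight n b)%R.
Proof.
move=> bn; rewrite /arc_weight divr_gt0 ?mulr_gt0 ?ltr0n ?max_arc_gt0 //.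
by rewrite addn2.
Qed.

Lemma arc_weight_le n b : b <= n -> (arc_weight n b <= (max_arc n b)%:R)%R.
Proof.
move=> bn; rewrite /arc_weight ler_pdivrMr ?ltr0n ?addn2 // -natrM -natrM ler_nat.
by apply: leq_mul => //; lia.
Qed.

Lemma arc_weight_lt n b : b < n -> (arc_weight n b < (max_arc n b)%:R)%R.
Proof.
move=> bn; rewrite /arc_weight ltr_pdivrMr ?ltr0n ?addn2 // -natrM -natrM ltr_nat.
by rewrite ltn_pmul2l ?max_arc_gt0 //; lia.
Qed.

Lemma potential_mono n b : b < n -> (potential n b <= potential n b.+1)%R.
Proof.
move=> bn; rewrite /potential same_parity_sumS /=.
case: (odd b) (odd n) => -[] /=; rewrite ?addn0 ?addr0 ?lerDl ?arc_weight_ge0 //.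
all: by rewrite natrD lerD2l arc_weight_le.
Qed.

Lemma potential_le n b c : b <= c -> c <= n -> (potential n b <= potential n c)%R.
Proof. exact: majorant_mono (@potential_mono n) b c. Qed.

(** The last step is excluded: [arc_weight n n] is all of [max_arc n n], so [potential] agrees at
    [n.-1] and [n]. *)
Lemma potential_ltS n b : b.+1 < n -> (potential n b < potential n b.+1)%R.
Proof.
move=> bn; rewrite /potential same_parity_sumS /=.
case: (odd b) (odd n) => -[] /=; rewrite ?addn0 ?addr0 ?ltrDl ?arc_weight_gt0 //.
all: by rewrite natrD ltrD2l arc_weight_lt.
Qed.

Lemma max_arc_split n k : k.+1 < n -> odd k.+1 != odd n ->
  ((max_arc n k.+1)%:R <=
    (max_arc n k)%:R - arc_weight n k + arc_weight n k.+2)%R /\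
  (k.+2 < n -> ((max_arc n k.+1)%:R <
    (max_arc n k)%:R - arc_weight n k + arc_weight n k.+2)%R).
Proof.
move=> kn par.
(* The outer parts for length [k.+1] are [m] and [m.+1]; the two ratio lemmas express both
   neighbouring weights through [max_arc n k.+1]. *)
have [m En] : exists m, n = m.*2 + k.+1 + 1 by exists ((n - k.+2)./2); lia.
have := max_arc_up En; have En' : n = m.+1.*2 + k by lia.
have := max_arc_down En'; rewrite /arc_weight.
have : 0 < max_arc n k.+1 by rewrite max_arc_gt0 // ltnW.
move: (max_arc n k) (max_arc n k.+1) (max_arc n k.+2) => A F B F0 EA EB.
have {}EA : (A%:R * (m%:R + 1) = F%:R * (k%:R + 1) :> rat)%R.
  by rewrite !natr1 -!natrM EA.
have {}EB : (B%:R * (k%:R + 2) = F%:R * (m%:R + 1) :> rat)%R.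
  by rewrite -[2%R]/(1 + 1)%R addrA !natr1 -!natrM EB.
have -> : ((n + k + 2)%:R = 2 * (m%:R + k%:R + 2) :> rat)%R.
  by rewrite En -!muln2; ring.
have -> : ((n + k.+2 + 2)%:R = 2 * (m%:R + k%:R + 3) :> rat)%R.
  by rewrite En -!muln2; ring.
have -> : ((k.+1.*2)%:R = 2 * (k%:R + 1) :> rat)%R.
  by rewrite -!muln2; ring.
have -> : ((k.+3.*2)%:R = 2 * (k%:R + 3) :> rat)%R.
  by rewrite -!muln2; ring.
have {F0} : (0 < F%:R :> rat)%R by rewrite ltr0n.
have k0 : (0 <= k%:R :> rat)%R by rewrite ler0n.
have m0 : (0 <= m%:R :> rat)%R by rewrite ler0n.
have mpos : k.+2 < n -> (0 < m%:R :> rat)%R by rewrite ltr0n; lia.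
move: k0 m0 mpos EA EB; clear En En'.
move: (k%:R)%R (m%:R)%R (A%:R)%R (B%:R)%R (F%:R)%R => {A B F m} u v A B F.
move=> u0 v0 vpos EA EB F0.
have -> : (A = F * (u + 1) / (v + 1))%R by rewrite -EA mulfK //; lra.
have -> : (B = F * (v + 1) / (u + 2))%R by rewrite -EB mulfK //; lra.
set Z := (X in (_ <= X)%R).
(* With [u] for [k] and [v] for [m], the slack is explicit: nonnegative, and positive once [m > 0],
   that is [k.+2 < n]. *)
have EZ : (Z - F = F * (v + 1) * v / ((u + 2) * (v + u + 2) * (v + u + 3)))%R.
  by rewrite /Z; field; do ?[apply/andP; split]; lra.
split; first rewrite -subr_ge0 EZ divr_ge0 ?mulr_ge0 //; try lra.
move=> /vpos v1; rewrite -subr_gt0 EZ divr_gt0 ?mulr_gt0 //; try lra.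
Qed.

(** The increment of [potential] from [b] to [b.+2] is the weight of the two edges at [b.+2]:
    exactly [max_arc n b.+2] for the parity of [n], and bounded below by [max_arc_split]
    otherwise. *)
Lemma potential_step n b : b.+2 <= n ->
  ((max_arc n b.+2)%:R + potential n b <= potential n b.+2)%R /\
  (odd b != odd n -> b.+3 < n ->
   ((max_arc n b.+2)%:R + potential n b < potential n b.+2)%R).
Proof.
move=> bn; rewrite /potential !same_parity_sumS /= negbK.
case: eqP => [Eb | /eqP Nb].
  have -> : ~~ odd b == odd n = false by rewrite Eb; case: (odd n).
  by rewrite addn0 natrD !addr0 addrC; split.
have -> : ~~ odd b == odd n by move: Nb; case: (odd b) (odd n) => -[].
have /max_arc_split[|le lt] : b.+2 < n by move: Nb; lia.
  by move: Nb; rewrite /= negbK.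
rewrite addn0 natrD; split=> [|_ /lt]; lra.
Qed.

(** For even [n] the edge [(0, 1)] carries no weight, so vertex 1 relies on [arc_weight n 2] alone.
    As [max_arc n 2] is [n / 4] times [max_arc n 1], the inequality amounts to [n + 4 <= 3 n / 2],
    that is [8 <= n]. *)
Lemma potential1 n : 0 < n -> odd n || (8 <= n) ->
  ((max_arc n 1)%:R <= potential n 1)%R.
Proof.
move=> n0; rewrite /potential same_parity_sumS.
rewrite [same_parity_sum n 0]big_geq // add0n.
case: (boolP (odd n)) => [on _ | evn /= n8].
  by rewrite eqxx addr0.
rewrite add0r /arc_weight.
have En : n = ((n./2).-1).*2 + 1 + 1 by lia.
rewrite ler_pdivlMr ?ltr0n ?addn2 // -natrM -natrM ler_nat.
have := max_arc_up En; move: (max_arc n 1) (max_arc n 2) => F B E.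
by nia.
Qed.

Lemma potential_ge0 n : (0 <= potential n 0)%R.
Proof.
rewrite /potential addr_ge0 ?ler0n //; case: ifP => // _.
exact: arc_weight_ge0.
Qed.

Lemma rsize_le_potential n r : 0 < n -> odd n || (8 <= n) -> rainbow n r ->
  ((rsize n r)%:R <= potential n (outer_len r))%R.
Proof.
move=> n0 n8; apply: rsize_le_majorant.
- exact: potential_ge0.
- exact: potential_mono.
- by move=> _; apply: potential1.
- by move=> b /potential_step[].
Qed.

(** * The bound as the size of the complete rainbow *)

Lemma max_arc_concentric n i : i.*2 <= n ->
  max_arc n (n - i.*2) = 'C(n, n - i) * 'C(n - i, i).
Proof.
move=> i2; rewrite -multinomE ?multinomE_len; try lia.
by rewrite /max_arc; congr ('C(_, _) * 'C(_, _)); lia.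
Qed.

(** Lengths are listed downwards, so that for the upper limit [n] the index [i] is the arc from [i]
    to [n - i]. The form [k.*2 + odd n] lets induction on [k] advance by two lengths. *)
Lemma same_parity_sumE n k : same_parity_sum n (k.*2 + odd n) =
  \sum_(0 <= i < k + odd n) max_arc n (k.*2 + odd n - i.*2).
Proof.
elim: k => [|k IH].
  rewrite !add0n; case En: (odd n); last first.
    by rewrite [same_parity_sum _ _]big_geq ?big_geq.
  by rewrite same_parity_sumS [same_parity_sum n 0]big_geq //= big_nat1 En.
have ob : odd (k.*2 + odd n) = odd n by rewrite oddD odd_double oddb.
rewrite doubleS !addSn big_nat_recl // !same_parity_sumS IH /= ob negbK eqxx.
have -> : ~~ odd n == odd n = false by case: (odd n).
by rewrite addn0 addnC subn0.
Qed.

Lemma potential_n n : 0 < n -> n \notin [:: 2; 4; 6] ->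
  (potential n n = (bound n)%:R)%R.
Proof.
move=> n0 Nn; rewrite /potential eqxx addr0 /bound (negPf Nn); congr (_%:R)%R.
have En : n = n./2.*2 + odd n by lia.
have -> : same_parity_sum n n = same_parity_sum n (n./2.*2 + odd n).
  by rewrite -En.
rewrite same_parity_sumE.
have -> : n./2 + odd n = ((n - 1)./2).+1 by lia.
apply: eq_big_nat => i /andP[_ ilt]; rewrite -En max_arc_concentric //; lia.
Qed.

Lemma rsize_complete_rainbow n : 0 < n -> n \notin [:: 2; 4; 6] ->
  rsize n (complete_rainbow n) = bound n.
Proof.
move=> n0 Nn; rewrite /bound (negPf Nn) /rsize /complete_rainbow big_map.
rewrite /index_iota subn0; apply: eq_big_seq => i; rewrite mem_iota /= => ilt.
by rewrite multinomE //; lia.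
Qed.

Lemma rainbow_complete n : 0 < n -> rainbow n (complete_rainbow n).
Proof.
move=> n0; rewrite /complete_rainbow; set k := (n - 1)./2.
apply/and5P; split=> //.
- by rewrite -map_comp map_id_in ?iota_ltn_sorted.
(* Truncated subtraction [n - i] is strictly decreasing only on [i <= n]. *)
- rewrite -map_comp sorted_map; apply: (@sub_in_sorted _ (fun i => i <= n) ltn).
  + by move=> i j; rewrite -!topredE /=; lia.
  + by apply/allP => i; rewrite mem_iota /=; lia.
  + exact: iota_ltn_sorted.
- by rewrite -[k.+1]addn1 iotaD map_cat last_cat /=; lia.
- by apply/allP => a /mapP[i _ ->] /=; apply: leq_subr.
Qed.

(** Deleting the midpoint leaves pairs symmetric about it, so even [n >= 8] is covered by the
    complete rainbow. *)
Lemma Rx_half n : ~~ odd n -> 0 < n -> Rx n n./2 = complete_rainbow n.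
Proof.
move=> evn n0; rewrite /Rx /complete_rainbow.
have -> : ((n - 1)./2).+1 = n./2 by lia.
have -> : [seq k <- iota 0 n.+1 | k != n./2] = iota 0 n./2 ++ iota n./2.+1 n./2.
  have -> : n.+1 = n./2 + 1 + n./2 by lia.
  rewrite !iotaD !filter_cat /= add0n eqxx addn1 cats0.
  by congr (_ ++ _); apply/all_filterP/allP => i; rewrite mem_iota; lia.
apply/eq_in_map => i; rewrite mem_iota /= add0n => ilt.
rewrite !nth_cat size_iota ilt.
have -> : n - 1 - i < n./2 = false by lia.
by rewrite !nth_iota //; try lia; congr (_, _); lia.
Qed.

(** * Uniqueness by complementary slackness *)

(** For even [n] and even [b <= n], the innermost arcs of the complete rainbow, of lengths [b],
    [b - 2], ..., 2. *)
Definition concentric n b := [seq (i, n - i) | i <- iota (n - b)./2 b./2].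

Lemma potential_lt n b c : b < c -> c < n -> (potential n b < potential n c)%R.
Proof.
elim: c => // c IH; rewrite ltnS leq_eqVlt => /orP[/eqP-> | bc] cn.
  exact: potential_ltS.
by apply: lt_trans (IH bc (ltnW cn)) (potential_ltS cn).
Qed.

(** An odd length from 3 up to below [n.-1] has slack of its own; for [n.-1] the slack comes from
    what lies inside. Length 1 is left out because [potential1] is an equality at [n = 8]. *)
Lemma rsize_lt_potential n r : ~~ odd n -> 8 <= n -> rainbow n r ->
  odd (outer_len r) -> 3 <= outer_len r ->
  ((rsize n r)%:R < potential n (outer_len r))%R.
Proof.
move=> evn n8; have n0 : 0 < n by lia.
have n8' : odd n || (8 <= n) by rewrite n8 orbT.
elim: r => [|a r IH] rb od ge3; first by [].
have /andP[lt_a an] := rainbow_head rb.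
have le_a : ((multinom n a.1 a.2)%:R <= (max_arc n (a.2 - a.1))%:R :> rat)%R.
  by rewrite ler_nat multinom_le_max_arc // ltnW.
have bn := rainbow_outer_len_le rb.
rewrite /rsize big_cons natrD -/(rsize n r).
move: le_a od ge3 bn => /=; set b := a.2 - a.1.
case Eb: b => [|[|c]] // le_a od c0 bn; have [step step_lt] := potential_step bn.
have c_odd : odd c by move: od => /=; rewrite negbK.
have IH' : ((rsize n r)%:R <= potential n c)%R /\
   (c.+3 = n -> ((rsize n r)%:R < potential n c)%R).
  case: r => [|b' r] in IH rb *.
    rewrite /rsize big_nil.
    have lt : (0 < potential n c)%R.
      by apply: le_lt_trans (potential_ge0 n) (potential_lt _ _); lia.
    by rewrite ltW.
  have [rb' len] := rainbow_outer_len rb isT.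
  have {}len : outer_len (b' :: r) <= c by move: len; rewrite /= -/b Eb; lia.
  have le := rsize_le_potential n0 n8' rb'.
  move: len; rewrite leq_eqVlt => /orP[/eqP E|lt_c].
    rewrite E in le; split=> // cn; rewrite -E; apply: IH => //; rewrite E //; lia.
  by have := potential_lt lt_c (ltnW bn); split; lra.
(* At [c.+3 = n] the outer step may be tight, so strictness is inherited from the inner arcs. *)
case: IH' => le lt; have [cn|cn] := eqVneq c.+3 n.
  by have := lt cn; lra.
have /step_lt : odd c != odd n by rewrite c_odd (negPf evn).
by move/(_ _); have -> : c.+3 < n by [move: evn; lia]; move/(_ isT); lra.
Qed.

(** Even lengths give tight steps, so equality forces the outer arc to be of maximal size, hence
    concentric, and the rest to be extremal too. Strict growth of [potential] below [n] fixes the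
    length of the rest. *)
Lemma rsize_eq_potential n r : ~~ odd n -> 8 <= n -> rainbow n r ->
  ~~ odd (outer_len r) -> ((rsize n r)%:R = potential n (outer_len r))%R ->
  r = concentric n (outer_len r).
Proof.
move=> evn n8; have n0 : 0 < n by lia.
have n8' : odd n || (8 <= n) by rewrite n8 orbT.
elim: r => [|a r IH] rb ev; first by case/andP: rb.
have /andP[lt_a an] := rainbow_head rb.
have leN_a : multinom n a.1 a.2 <= max_arc n (a.2 - a.1).
  by rewrite multinom_le_max_arc // ltnW.
have le_a : ((multinom n a.1 a.2)%:R <= (max_arc n (a.2 - a.1))%:R :> rat)%R.
  by rewrite ler_nat.
have eq_a := multinom_eq_max_arc (ltnW lt_a) an.
have bn := rainbow_outer_len_le rb.
rewrite /rsize big_cons natrD -/(rsize n r).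
move: leN_a le_a eq_a ev bn => /=; set b := a.2 - a.1.
case Eb: b => [|[|c]] leN_a le_a eq_a //; first by lia.
move=> ev bn; rewrite /= negbK in ev.
have [step _] := potential_step bn.
have Pc : (potential n c.+2 = (max_arc n c.+2)%:R + potential n c)%R.
  rewrite /potential !same_parity_sumS /= negbK (negPf ev) (negPf evn) /=.
  by rewrite addn0 natrD; lra.
rewrite Pc => Esz.
have IH' : ((rsize n r)%:R <= potential n c)%R /\
   ((rsize n r)%:R = potential n c -> r = concentric n c)%R.
  case: r => [|b' r] in IH rb Esz *.
    rewrite /rsize big_nil; split.
      by apply: le_trans (potential_ge0 n) (potential_le _ _) => //; lia.
    (* An empty rest is extremal only for [c = 0], where [concentric n 0] is empty as well. *)
    have [-> // | c0] := posnP c.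
    move=> Pc0; exfalso; move: Pc0; have := potential_lt c0 (ltnW bn).
    by have := potential_ge0 n; lra.
  have [rb' len] := rainbow_outer_len rb isT.
  have {}len : outer_len (b' :: r) <= c by move: len; rewrite /= -/b Eb; lia.
  have le := rsize_le_potential n0 n8' rb'.
  move: len; rewrite leq_eqVlt => /orP[/eqP E|lt_c].
    rewrite E in le; split=> // E'; rewrite -E; apply: IH => //; rewrite E //.
  have lt_P := potential_lt lt_c (ltnW bn).
  split=> [|Ec]; first lra.
  by have := le_lt_trans le lt_P; rewrite Ec ltxx.
case: IH' => le eq_r.
have Ea : ((multinom n a.1 a.2)%:R = (max_arc n c.+2)%:R :> rat)%R by lra.
rewrite [r in LHS]eq_r; last by lra.
have sum_a : a.1 + a.2 = n.
  apply: eq_a; first by lia.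
  by apply/eqP; rewrite -(eqr_nat rat) Ea.
rewrite /concentric /=; have -> : (n - c)./2 = (n - c.+2)./2.+1 by lia.
congr (_ :: _); rewrite [LHS]surjective_pairing; congr (_, _); lia.
Qed.

(** A majorant given by a table of integers, whose hypotheses can be computed; it serves
    [n = 2, 4, 6], where the inequality of [potential1] fails. *)
Lemma rsize_le_nat_majorant n (s : seq nat) r : size s = n.+1 ->
  sorted leq s -> max_arc n 1 <= nth 0 s 1 ->
  all (fun b => max_arc n b.+2 + nth 0 s b <= nth 0 s b.+2) (iota 0 n.-1) ->
  rainbow n r -> rsize n r <= nth 0 s n.
Proof.
move=> sz srt s1 /allP st rb; rewrite -(ler_nat rat).
apply: (@rsize_le_majorant_n n (fun b => (nth 0 s b)%:R)%R) rb => //=.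
- by move=> b bn; rewrite ler_nat; move/(sortedP 0): srt; apply; rewrite sz ltnS.
- by move=> _; rewrite ler_nat.
- by move=> b bn; rewrite -natrD ler_nat; apply: st; rewrite mem_iota; lia.
Qed.

Lemma rsize_le_bound n r : 0 < n -> rainbow n r -> rsize n r <= bound n.
Proof.
move=> n0 rb.
have [small|Nn] := boolP (n \in [:: 2; 4; 6]); last first.
  have n8 : odd n || (8 <= n) by move: Nn; rewrite !inE; lia.
  rewrite -(ler_nat rat) -potential_n //.
  apply: rsize_le_majorant_n rb.
  - exact: potential_ge0.
  - exact: potential_mono.
  - by move=> _; apply: potential1.
  - by move=> b /potential_step[].
(* The lists give, for each [b], the maximum of [\sum_j max_arc n j] over sets of
   lengths [j <= b] without consecutive elements. *)
rewrite /bound small; move: small; rewrite !inE => /or3P[]/eqP n_eq; subst n.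
- apply: leq_trans (@rsize_le_nat_majorant 2 [:: 0; 2; 2] r _ _ _ _ rb) _ => //.
  by rewrite unlock.
- apply: leq_trans (@rsize_le_nat_majorant 4
    [:: 0; 12; 12; 16; 16] r _ _ _ _ rb) _ => //.
  by rewrite unlock.
- apply: leq_trans (@rsize_le_nat_majorant 6
    [:: 0; 60; 90; 120; 120; 126; 126] r _ _ _ _ rb) _ => //.
  by rewrite unlock.
Qed.

Lemma rsize_eq_bound n r : ~~ odd n -> 8 <= n -> rainbow n r ->
  rsize n r = bound n -> r = Rx n n./2.
Proof.
move=> evn n8 rb E; have n0 : 0 < n by lia.
have n8' : odd n || (8 <= n) by rewrite n8 orbT.
have Nn : n \notin [:: 2; 4; 6] by rewrite !inE; lia.
have {}E : ((rsize n r)%:R = potential n n)%R by rewrite E potential_n.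
have le := rsize_le_potential n0 n8' rb.
have ltP b : b.+1 < n -> (potential n b < potential n n)%R.
  move=> bn; apply: lt_le_trans (potential_ltS bn) _.
  exact: potential_le (ltnW bn) (leqnn n).
(* Outer lengths below [n.-1] have smaller potential; [n.-1] has that of [n] but is odd, hence never
   tight. *)
have Er : outer_len r = n.
  have [//|ne] := eqVneq (outer_len r) n; exfalso.
  have lt_n : outer_len r < n by rewrite ltn_neqAle ne rainbow_outer_len_le.
  have [/ltP lt|ge] := ltnP (outer_len r).+1 n.
    by move: (le_lt_trans le lt); rewrite E ltxx.
  have := rsize_lt_potential evn n8 rb; have En : outer_len r = n.-1 by lia.
  rewrite En => /(_ _)/(_ _); have -> : odd n.-1 by lia.
  have -> : 3 <= n.-1 by lia.
  have h := potential_le (leq_pred n) (leqnn n); move=> /(_ isT isT).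
  by rewrite E; lra.
have := rsize_eq_potential evn n8 rb; rewrite Er => /(_ evn E) ->.
rewrite Rx_half // /concentric /complete_rainbow subnn.
by congr (map _ (iota _ _)); lia.
Qed.

Lemma small_Rx n x : n \in [:: 2; 4; 6] -> (x == 0) || (x == n) ->
  rainbow n (Rx n x) /\ rsize n (Rx n x) = bound n.
Proof.
rewrite !inE => /or3P[]/eqP-> /orP[]/eqP->; split=> //; rewrite /rsize /bound unlock //.
Qed.

(** * Transfer systems *)

Section TransferSystemTheory.
Variables (gT : finGroupType) (G : {group gT}).
Implicit Types (S T : {set arrow_type gT}) (A B H K L : {group gT}).

Lemma transferP T : reflect
  [/\ {in T, forall a, is_arrow G a},
      forall H, H \subset G -> (H, H) \in T,
      forall H K L, (H, K) \in T -> (K, L) \in T -> (H, L) \in T,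
      forall H K g, g \in G -> (H, K) \in T -> ((H :^ g)%G, (K :^ g)%G) \in T &
      forall H K L, (H, K) \in T -> L \subset K -> ((H :&: L)%G, L) \in T]
  (transferb G T).
Proof.
apply: (iffP and5P) => [[t1 t2 t3 t4 t5] | [t1 t2 t3 t4 t5]]; split.
- exact/forall_inP.
- by move=> H; move/forallP/(_ H)/implyP: t2.
- move=> H K L HK KL; move/'forall_'forall_forallP/(_ H K L)/implyP: t3.
  by apply; rewrite HK.
- move=> H K g gG HK; move/'forall_forallP/(_ H K)/forall_inP/(_ g gG)/implyP: t4.
  exact.
- move=> H K L HK LK; move/'forall_'forall_forallP/(_ H K L)/implyP: t5.
  by apply; rewrite HK.
- exact/forall_inP.
- by apply/forallP => H; apply/implyP/t2.
- by apply/'forall_'forall_forallP => H K L; apply/implyP => /andP[]; apply: t3.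
- apply/'forall_forallP => H K; apply/forall_inP => g gG; apply/implyP.
  exact: t4.
- by apply/'forall_'forall_forallP => H K L; apply/implyP => /andP[]; apply: t5.
Qed.

Lemma sub_gen S : S \subset gen G S.
Proof. by apply/bigcapsP => T /andP[]. Qed.

Lemma gen_sub S T : transferb G T -> S \subset T -> gen G S \subset T.
Proof. by move=> tT ST; apply: bigcap_inf; rewrite tT. Qed.

Lemma in_gen S a : reflect
  (forall T, transferb G T -> S \subset T -> a \in T) (a \in gen G S).
Proof.
apply: (iffP bigcapP) => [h T tT ST | h T /andP[]]; last exact: h.
by apply: h; rewrite tT.
Qed.

Lemma transfer_arrows : transferb G [set a | is_arrow G a].
Proof.
apply/transferP; split.
- by move=> a; rewrite inE.
- by move=> H; rewrite inE /is_arrow /= subxx.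
- move=> H K L; rewrite !inE /is_arrow /= => /andP[HK _] /andP[KL ->].
  by rewrite (subset_trans HK KL).
- move=> H K g gG; rewrite !inE /is_arrow /= conjSg => /andP[-> KG].
  by rewrite -(conjGid gG) conjSg.
- move=> H K L; rewrite !inE /is_arrow /= subsetIr => /andP[_ KG] LK.
  exact: subset_trans KG.
Qed.

Lemma transfer_gen S : {in S, forall a, is_arrow G a} -> transferb G (gen G S).
Proof.
move=> arrS; apply/transferP; split.
- have /subsetP h : gen G S \subset [set a | is_arrow G a].
    by apply: gen_sub transfer_arrows _; apply/subsetP => a /arrS; rewrite inE.
  by move=> a /h; rewrite inE.
- by move=> H HG; apply/in_gen => T /transferP[_ t _ _ _] _; apply: t.
- move=> H K L /in_gen HK /in_gen KL; apply/in_gen => T tT ST.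
  by have /transferP[_ _ t _ _] := tT; apply: t (HK T tT ST) (KL T tT ST).
- move=> H K g gG /in_gen HK; apply/in_gen => T tT ST.
  by have /transferP[_ _ _ t _] := tT; apply: t gG (HK T tT ST).
- move=> H K L /in_gen HK LK; apply/in_gen => T tT ST.
  by have /transferP[_ _ _ _ t] := tT; apply: t (HK T tT ST) LK.
Qed.

(* Omits [(A, B)], but contains every arrow not above it componentwise. *)
Definition avoiding A B : {set arrow_type gT} :=
  [set a | is_arrow G a &
     [&& A \subset a.1 & B \subset a.2] ==> (B \subset a.1)].

(** For [(H, K)] and [(K, L)] the inclusion of [B] descends from [L] to [K] and then to [H]; under
    restriction [B] lies in [H] and in [L]. Conjugation fixes subgroups of an abelian group. *)
Lemma transfer_avoiding A B : abelian G -> transferb G (avoiding A B).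
Proof.
move=> abG; have /transferP[_ tid tcomp tconj tres] := transfer_arrows.
have inT a : (a \in [set b | is_arrow G b]) = is_arrow G a by rewrite inE.
have fixG H g : g \in G -> H \subset G -> (H :^ g)%g = H.
  by move=> gG HG; apply: normsP (sub_abelian_norm abG HG) g gG.
apply/transferP; split.
- by move=> a; rewrite inE => /andP[].
- move=> H HG; rewrite inE -inT tid //=; apply/implyP => /andP[] //.
- move=> H K L; rewrite !inE => /andP[HK /implyP h1] /andP[KL /implyP h2].
  rewrite -inT (tcomp H K L) ?inE //=; apply/implyP => /andP[AH BL].
  apply: h1; rewrite AH h2 // BL andbT.
  by case/andP: HK => HK _; apply: subset_trans HK.
- move=> H K g gG; rewrite !inE => /andP[HK h].
  rewrite -inT tconj ?inE //=.
  by case/andP: HK => /= HK KG; rewrite !fixG // (subset_trans HK).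
- move=> H K L; rewrite !inE => /andP[HK /implyP h] LK.
  rewrite -inT (tres H K) ?inE //=; apply/implyP => /andP[].
  rewrite !subsetI => /andP[AH AL] BL; rewrite BL h // AH.
  exact: subset_trans LK.
Qed.

Lemma minimal_gen_antichain S : abelian G -> {in S, forall a, is_arrow G a} ->
  {in S, forall a, a.1 != a.2} ->
  {in S &, forall a b : arrow_type gT, a.1 \subset b.1 -> a.2 \subset b.2 -> a = b} ->
  minimal_genb G S (gen G S).
Proof.
move=> abG arrS neS antiS; apply/and4P; split=> //.
- exact/forall_inP.
- exact: sub_gen.
apply/forall_inP => -[A B] sS; apply/eqP => E.
have /andP[/= AB BG] := arrS _ sS.
have: (A, B) \in gen G (S :\ (A, B)) by rewrite E (subsetP (sub_gen S)).
have tA := transfer_avoiding A B abG.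
(* No other arrow of [S] lies above [(A, B)], so the implication in [avoiding] holds vacuously. *)
have sub : S :\ (A, B) \subset avoiding A B.
  apply/subsetP => a; rewrite !inE => /andP[ne aS].
  rewrite arrS //=; apply/implyP => /andP[A1 B2].
  by rewrite (antiS (A, B) a) ?eqxx in ne.
move/(subsetP (gen_sub tA sub)); rewrite inE /= !subxx /=.
have /negPf -> : ~~ (B \subset A).
  apply: contra (neS _ sS) => /= BA; apply/eqP/val_inj/eqP.
  by rewrite eqEsubset AB.
by rewrite andbF.
Qed.

Lemma leq_cfrak S : {in S, forall a, is_arrow G a} ->
  minimal_genb G S (gen G S) -> #|S| <= cfrak G.
Proof.
move=> arrS minS; rewrite /cfrak.
apply: leq_trans (leq_bigmax_cond _ (transfer_gen arrS)).
exact: (@leq_bigmax_cond _ (fun S' => minimal_genb G S' (gen G S)) _ S).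
Qed.

End TransferSystemTheory.

(** * Arcs in a cyclic group of squarefree order *)

Section SquarefreeCyclic.
Variables (gT : finGroupType) (G : {group gT}) (n : nat) (p : 'I_n -> nat).
Hypotheses (p_inj : injective p) (p_pr : forall i, prime (p i)).
Hypotheses (cycG : cyclic G) (oG : #|G| = \prod_(i < n) p i).
Implicit Types I J : {set 'I_n}.

Let d I := \prod_(i in I) p i.

Lemma dvdn_prod_primes I J : (d I %| d J) = (I \subset J).
Proof.
apply/idP/idP => [dv | IJ].
  apply/subsetP => i iI.
  have : p i %| d J by apply: dvdn_trans dv; rewrite /d (bigD1 i) //= dvdn_mulr.
  rewrite /d Euclid_dvd_prod // big_has_cond => /hasP[j _ /andP[jJ]].
  by rewrite dvdn_prime2 // => /eqP/p_inj->.
rewrite /d [X in _ %| X](big_setID I) /= (setIidPr IJ); exact: dvdn_mulr.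
Qed.

Lemma exists_subgroup I : exists H : {group gT}, (H \subset G) && (#|H| == d I).
Proof.
have /cyclicP[a defG] := cycG.
have dv : d I %| #[a]%g.
  rewrite orderE -defG oG; have -> : \prod_(i < n) p i = d setT.
    by apply: eq_bigl => i; rewrite inE.
  by rewrite dvdn_prod_primes subsetT.
have := cycle_sub_group dv; set H := <[_]>%G => /setP/(_ H).
by rewrite !inE eqxx -defG; exists H.
Qed.

(** A cyclic group has one subgroup of each order dividing its own, so the choice is forced; arrows
    become nested pairs of subsets of ['I_n]. *)
Definition subgroup_of I : {group gT} := xchoose (exists_subgroup I).

Lemma subgroup_of_sub I : subgroup_of I \subset G.
Proof. by case/andP: (xchooseP (exists_subgroup I)). Qed.

Lemma card_subgroup_of I : #|subgroup_of I| = d I.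
Proof. by case/andP: (xchooseP (exists_subgroup I)) => _ /eqP. Qed.

Lemma subgroup_ofS I J : (subgroup_of I \subset subgroup_of J) = (I \subset J).
Proof.
by rewrite -(cardSg_cyclic cycG) ?subgroup_of_sub // !card_subgroup_of
  dvdn_prod_primes.
Qed.

Lemma subgroup_of_inj : injective subgroup_of.
Proof.
by move=> I J E; apply/eqP; rewrite eqEsubset -!subgroup_ofS E subxx.
Qed.

Lemma subgroup_ofP (H : {group gT}) I : H \subset G -> #|H| = d I ->
  H = subgroup_of I.
Proof.
move=> HG oH; apply/val_inj/eqP.
by rewrite (eq_subG_cyclic cycG) ?subgroup_of_sub //= card_subgroup_of oH.
Qed.

Lemma arc_arrowsE x y : arc_arrows G p x y =
  [set (subgroup_of IJ.1, subgroup_of IJ.2) |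
     IJ in [set IJ : {set 'I_n} * {set 'I_n} |
       [&& IJ.1 \subset IJ.2, #|IJ.1| == x & #|IJ.2| == y]]].
Proof.
apply/setP => -[H K]; apply/idP/imsetP.
  rewrite inE => /and3P[/andP[/= HK KG]].
  case/existsP => I /andP[cI /eqP oH] /existsP[J /andP[cJ /eqP oK]].
  have EH := subgroup_ofP (subset_trans HK KG) oH.
  have EK := subgroup_ofP KG oK.
  exists (I, J); last by rewrite /= -EH -EK.
  by rewrite inE /= cI cJ -subgroup_ofS -EH -EK HK.
case=> -[I J]; rewrite inE /= => /and3P[IJ cI cJ] [-> ->].
rewrite inE /is_arrow /= subgroup_ofS IJ subgroup_of_sub /=; apply/andP; split.
  by apply/existsP; exists I; rewrite cI card_subgroup_of /=.
by apply/existsP; exists J; rewrite cJ card_subgroup_of /=.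
Qed.

Lemma card_arc_arrows x y : #|arc_arrows G p x y| = 'C(n, y) * 'C(y, x).
Proof.
rewrite arc_arrowsE card_imset; last first.
  by move=> [I J] [I' J'] [/subgroup_of_inj-> /subgroup_of_inj->].
(* After the swap the larger set is chosen first, then the smaller one inside it. *)
rewrite -sum1_card (reindex_inj (can_inj (@swap_pairK _ _))) /=.
rewrite (eq_bigl (fun JI : {set 'I_n} * {set 'I_n} =>
   (#|JI.1| == y) && ((JI.2 \subset JI.1) && (#|JI.2| == x)))); last first.
  by case=> J I; rewrite inE /= [RHS]andbC andbA.
rewrite -(pair_big_dep (fun J : {set 'I_n} => #|J| == y)
  (fun J I : {set 'I_n} => (I \subset J) && (#|I| == x)) (fun _ _ => 1)) /=.
rewrite (eq_bigr (fun=> 'C(y, x))) => [|J /eqP cJ].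
  rewrite sum_nat_const; congr (_ * _).
  by rewrite -[in RHS](card_ord n) -card_draws; apply: eq_card => J; rewrite inE.
by rewrite sum1_card -[in RHS]cJ -cards_draws; apply: eq_card => I; rewrite inE.
Qed.

Lemma arc_arrows_le x y x' y' a b :
  a \in arc_arrows G p x y -> b \in arc_arrows G p x' y' ->
  a.1 \subset b.1 -> a.2 \subset b.2 -> x <= x' /\ y <= y'.
Proof.
rewrite !arc_arrowsE => /imsetP[[I J]]; rewrite inE => /and3P[_ /eqP<- /eqP<-] ->.
move=> /imsetP[[I' J']]; rewrite inE => /and3P[_ /eqP<- /eqP<-] -> /=.
by rewrite !subgroup_ofS => /subset_leq_card-> /subset_leq_card->.
Qed.

Lemma arc_arrows_anti x y a b :
  a \in arc_arrows G p x y -> b \in arc_arrows G p x y ->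
  a.1 \subset b.1 -> a.2 \subset b.2 -> a = b.
Proof.
rewrite !arc_arrowsE => /imsetP[[I J]]; rewrite inE => /and3P[_ /eqP cI /eqP cJ] ->.
move=> /imsetP[[I' J']]; rewrite inE => /and3P[_ /eqP cI' /eqP cJ'] -> /=.
rewrite !subgroup_ofS => sI sJ.
have/eqP-> : I == I' by rewrite eqEcard sI cI -cI' /=.
by have/eqP-> : J == J' by rewrite eqEcard sJ cJ -cJ' /=.
Qed.

Lemma rainbow_arrowsP r a : reflect
  (exists2 c, c \in r & a \in arc_arrows G p c.1 c.2)
  (a \in rainbow_arrows G p r).
Proof.
rewrite /rainbow_arrows; elim: r => [|c r IH].
  by rewrite big_nil inE; constructor=> -[].
rewrite big_cons inE; apply: (iffP orP) => [[ac | /IH[c' c'r ac']] | [c']].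
- by exists c; rewrite ?mem_head.
- by exists c'; rewrite // inE c'r orbT.
- by rewrite inE => /predU1P[-> | c'r] ac; [left | right; apply/IH; exists c'].
Qed.

Lemma rainbow_arrows_arrow r : {in rainbow_arrows G p r, forall a, is_arrow G a}.
Proof. by move=> a /rainbow_arrowsP[c _]; rewrite inE => /andP[]. Qed.

Lemma card_rainbow_arrows r : rainbow n r -> #|rainbow_arrows G p r| = rsize n r.
Proof.
(* Only distinctness of the arcs and bounds on their endpoints are kept: unlike [rainbow], these
   pass to every tail, even the empty one. *)
move=> rb; have := rainbow_mem rb; have := rainbow_uniq rb.
rewrite /rsize {rb}; elim: r => [|c r IH]; first by
  rewrite /rainbow_arrows !big_nil cards0.
move=> /= /andP[c_r Ur] mem_r.
rewrite /rainbow_arrows !big_cons -/(rainbow_arrows G p r) cardsU.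
have -> : arc_arrows G p c.1 c.2 :&: rainbow_arrows G p r = set0.
  apply/setP => a; rewrite in_set0 in_setI; apply/negP => /andP[ac].
  case/rainbow_arrowsP => c' c'r ac'; case/negP: c_r.
  have [le1 le2] := arc_arrows_le ac ac' (subxx _) (subxx _).
  have [ge1 ge2] := arc_arrows_le ac' ac (subxx _) (subxx _).
  rewrite [c]surjective_pairing.
  have -> : c.1 = c'.1 by apply/eqP; rewrite eqn_leq le1.
  have -> : c.2 = c'.2 by apply/eqP; rewrite eqn_leq le2.
  by rewrite -surjective_pairing.
rewrite cards0 subn0 IH // => [|c' c'r]; last by rewrite mem_r // inE c'r orbT.
have /mem_r/andP[/ltnW c12 cn] := mem_head c r.
by rewrite card_arc_arrows multinomE.
Qed.

(** Comparable arrows have comparable levels, hence lie in one arc by [rainbow_nested], where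
    [arc_arrows_anti] makes them equal. *)
Lemma rainbow_minimal_gen r : rainbow n r ->
  minimal_genb G (rainbow_arrows G p r) (gen G (rainbow_arrows G p r)).
Proof.
move=> rb; apply: minimal_gen_antichain; first exact: cyclic_abelian.
- exact: rainbow_arrows_arrow.
- move=> [H K] /rainbow_arrowsP[c cr]; rewrite arc_arrowsE.
  case/imsetP=> -[I J]; rewrite inE => /and3P[_ /eqP /= cI /eqP cJ] [-> ->].
  apply/eqP => /subgroup_of_inj E.
  by have := rainbow_mem rb cr; rewrite -cI -cJ /= E ltnn.
move=> a b /rainbow_arrowsP[c cr ac] /rainbow_arrowsP[c' c'r bc'] ab1 ab2.
have [le1 le2] := arc_arrows_le ac bc' ab1 ab2.
have Ec := rainbow_nested rb cr c'r le1 le2; rewrite -Ec in bc'.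
exact: arc_arrows_anti ac bc' ab1 ab2.
Qed.

Lemma rainbow_attains r : rainbow n r -> rsize n r = bound n -> attains G p r.
Proof.
by move=> rb E; split=> //; [exact: card_rainbow_arrows | exact: rainbow_minimal_gen].
Qed.

Lemma attains_cfrak r : attains G p r -> bound n <= cfrak G.
Proof.
by case=> rb <- <- mg; apply: leq_cfrak mg; apply: rainbow_arrows_arrow.
Qed.

End SquarefreeCyclic.

Theorem theorem5p14 (gT : finGroupType) (G : {group gT}) (n : nat) (p : 'I_n -> nat) :
  0 < n -> injective p -> (forall i, prime (p i)) ->
  cyclic G -> #|G| = (\prod_(i < n) p i)%N ->
  [/\ bound n <= cfrak G,
      (forall r, rainbow n r -> rsize n r <= bound n),
      (odd n -> attains G p (complete_rainbow n)),
      (~~ odd n -> 8 <= n ->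
         attains G p (Rx n n./2) /\
         (forall r, rainbow n r -> rsize n r = bound n -> r = Rx n n./2)) &
      (n \in [:: 2; 4; 6] -> attains G p (Rx n 0) /\ attains G p (Rx n n))].
Proof.
move=> n0 p_inj p_pr cycG oG; have att := rainbow_attains p_inj p_pr cycG oG.
have att_complete : n \notin [:: 2; 4; 6] -> attains G p (complete_rainbow n).
  move=> Nn; apply: att; first exact: rainbow_complete.
  exact: rsize_complete_rainbow.
have att_small x : n \in [:: 2; 4; 6] -> (x == 0) || (x == n) -> attains G p (Rx n x).
  by move=> small xn; have [rb E] := small_Rx small xn; apply: att.
split.
(* One attaining rainbow suffices: [R[0]] for the exceptional [n], the complete rainbow
   otherwise. *)
- have [small|Nn] := boolP (n \in [:: 2; 4; 6]).
    exact: attains_cfrak (att_small 0 small _).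
  exact: attains_cfrak (att_complete Nn).
- by move=> r; apply: rsize_le_bound.
- by move=> on; apply: att_complete; rewrite !inE; lia.
- move=> evn n8; split; last by move=> r; apply: rsize_eq_bound.
  by rewrite Rx_half //; apply: att_complete; rewrite !inE; lia.
- by move=> small; split; apply: att_small; rewrite ?eqxx ?orbT.
Qed.
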